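(* Let $S$ be a semigroup and $I$ an ideal of $S$. Then $S$ satisfies $M_L$ if and only if both $I$ and the Rees quotient $S/I$ satisfy $M_L$.
   Context: For a semigroup $S$, $S^1$ denotes the monoid obtained from $S$ by adjoining a new identity $1$. Green's $\mathcal L$-preorder on $S$ is $a\leq_{\mathcal L}b\Leftrightarrow S^1a\subseteq S^1b$; it induces an equivalence relation $\mathcal L$ and a partial order on the set of $\mathcal L$-classes. A semigroup satisfies $M_L$ if every non-empty set of its $\mathcal L$-classes contains a minimal member. An ideal of $S$ is a subset $I$ with $SI\subseteq I$ and $IS\subseteq I$; ''$I$ satisfies $M_L$'' refers to $I$ as a semigroup in its own right. The Rees quotient $S/I$ is the semigroup with underlying set $(S\setminus I)\sqcup\{0\}$ and multiplication $a\cdot b=ab$ if $a,b,ab\in S\setminus I$, and $a\cdot b=0$ otherwise. *)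

(* Defs.v *)
From HB Require Import structures.
From mathcomp Require Import all_boot monoid.
From mathcomp Require Import boolp classical_sets.

Set Implicit Arguments.
Unset Strict Implicit.
Unset Printing Implicit Defensive.

Local Open Scope classical_set_scope.
Local Open Scope group_scope.

(* The monoid S^1: [None] is the new identity, adjoined even when S already
   has one. *)

Definition adjoin1 (S : semigroupType) : Type := option S.

Section Adjoin1.
Variable S : semigroupType.

HB.instance Definition _ := Choice.copy (adjoin1 S) (option S).

Definition adjoin1_mul (x y : adjoin1 S) : adjoin1 S :=
  match x, y with
  | None, _ => y
  | _, None => x
  | Some a, Some b => Some (a * b)
  end.

Lemma adjoin1_mulA : associative adjoin1_mul.
Proof. by move=> [x|] [y|] [z|] //=; rewrite mulgA. Qed.

Lemma adjoin1_mul1 : left_id (None : adjoin1 S) adjoin1_mul.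
Proof. by case. Qed.

Lemma adjoin1_mulr1 : right_id (None : adjoin1 S) adjoin1_mul.
Proof. by case. Qed.

HB.instance Definition _ :=
  isMonoid.Build (adjoin1 S) adjoin1_mulA adjoin1_mul1 adjoin1_mulr1.

Definition to_adjoin1 (a : S) : adjoin1 S := Some a.

End Adjoin1.

Section GreenL.
Variable S : semigroupType.

Definition principal_left_ideal (a : S) : set (adjoin1 S) :=
  [set s * to_adjoin1 a | s in [set: adjoin1 S]].

Definition leL (a b : S) : Prop :=
  principal_left_ideal a `<=` principal_left_ideal b.

Definition eqL (a b : S) : Prop := leL a b /\ leL b a.

Definition Lclass (a : S) : set S := [set b | eqL a b].

Definition Lclasses : set (set S) := range Lclass.

(* On L-classes this does not depend on the chosen representatives. *)
Definition leLclass (X Y : set S) : Prop :=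
  exists a b, [/\ X a, Y b & leL a b].

Definition satisfies_ML : Prop :=
  forall C : set (set S), C `<=` Lclasses -> C !=set0 ->
    exists2 X, C X & forall Y, C Y -> leLclass Y X -> Y = X.

End GreenL.

Arguments satisfies_ML S : clear implicits.

(* The empty set is allowed as an ideal. *)
Record ideal (S : semigroupType) := Ideal {
  ideal_set :> set S;
  ideal_mull : forall s a, ideal_set a -> ideal_set (s * a);
  ideal_mulr : forall s a, ideal_set a -> ideal_set (a * s)
}.

Definition ideal_semigroup (S : semigroupType) (I : ideal S) : Type :=
  set_type I.

Section IdealSemigroup.
Variables (S : semigroupType) (I : ideal S).

HB.instance Definition _ := SubChoice.copy (ideal_semigroup I) (set_type I).

Lemma ideal_mulg_closed : mulg_closed (mem (I : set S)).
Proof.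
by move=> a b aI bI; apply/mem_set/ideal_mull; exact: set_mem bI.
Qed.

HB.instance Definition _ :=
  SubChoice_isSubSemigroup.Build S (mem (I : set S)) (ideal_semigroup I)
    ideal_mulg_closed.

End IdealSemigroup.

(* The Rees quotient S/I: [None] is the zero. *)
Definition rees_quotient (S : semigroupType) (I : ideal S) : Type :=
  option (set_type (~` I)).

Section ReesQuotient.
Variables (S : semigroupType) (I : ideal S).

HB.instance Definition _ :=
  Choice.copy (rees_quotient I) (option (set_type (~` I))).

(* [insub c] is [Some c] if c lies outside I, and [None] otherwise. *)
Definition rees_mul (x y : rees_quotient I) : rees_quotient I :=
  match x, y with
  | Some a, Some b => insub (val a * val b)
  | _, _ => None
  end.

Lemma rees_mulA : associative rees_mul.
Proof.
have inI c : c \notin ~` I -> (I : set S) c.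
  by move=> cI; apply: contrapT => nIc; move/negP: cI; apply; apply/mem_set.
have outI c : (I : set S) c -> insub c = None :> rees_quotient I.
  by move=> Ic; apply: insubN; apply/negP => /set_mem.
move=> [x|] [y|] [z|] //=; last by case: insubP.
case: (insubP _ (val y * val z)) => [yz _ Eyz|/inI Iyz];
  case: (insubP _ (val x * val y)) => [xy _ Exy|/inI Ixy] //=.
- by move: Exy Eyz => /= -> ->; rewrite mulgA.
- by move: Eyz => /= ->; rewrite mulgA; apply: outI; exact: ideal_mulr.
- by move: Exy => /= ->; rewrite -mulgA; apply/esym/outI; exact: ideal_mull.
Qed.

HB.instance Definition _ := isSemigroup.Build (rees_quotient I) rees_mulA.

End ReesQuotient.

(* Main.v *)
(** [M_L] says that every non-empty subset has an element minimal for the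
    L-preorder.  The delicate case is a subset A of S meeting I, when I and S/I
    satisfy [M_L].  Let a be minimal in the intersection of A and I for the
    L-preorder of I.  If t * a lies in A for some t in I, then a = u * a for
    some u in I, so that every s * a equals (s * u) * a with s * u in I, and a
    is minimal in A.  Otherwise all t with t * a in A lie outside I; if there
    is any, choose one that is minimal in S/I, and then t * a is minimal in A;
    if there is none, a is minimal in A. *)

Require Import Defs.
From mathcomp Require Import all_boot monoid.
From mathcomp Require Import boolp classical_sets.

Set Implicit Arguments.
Unset Strict Implicit.
Unset Printing Implicit Defensive.

Local Open Scope classical_set_scope.
Local Open Scope group_scope.

Section LPreorder.
Variable S : semigroupType.
Implicit Types a b c s : S.

Lemma leLP a b : leL a b <-> a = b \/ exists s, a = s * b.
Proof.
split=> [ab|[->|[s ->]] _ [t _ <-]]; first 1 last.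
- by exists t.
- by exists (t * to_adjoin1 s) => //; rewrite -mulgA.
have [|[s|] _] := ab (to_adjoin1 a).
- by exists None.
- by move=> [<-]; right; exists s.
- by move=> [<-]; left.
Qed.

Lemma leL_refl a : leL a a.
Proof. by []. Qed.

Lemma Lclass_refl a : Lclass a a.
Proof. by split; exact: leL_refl. Qed.

Lemma leL_trans b a c : leL a b -> leL b c -> leL a c.
Proof. exact: subset_trans. Qed.

Lemma leL_mull s a : leL (s * a) a.
Proof. by apply/leLP; right; exists s. Qed.

Lemma leL_mulr c a b : leL a b -> leL (a * c) (b * c).
Proof.
by move=> /leLP[->//|[s ->]]; rewrite -mulgA; exact: leL_mull.
Qed.

Lemma eq_Lclass a b : eqL a b -> Lclass a = Lclass b.
Proof.
move=> [ab ba]; apply/seteqP; split=> c [] h1 h2; split.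
- exact: leL_trans ba h1.
- exact: leL_trans h2 ab.
- exact: leL_trans ab h1.
- exact: leL_trans h2 ba.
Qed.

Definition minimalL (A : set S) a := A a /\ forall b, A b -> leL b a -> leL a b.

(** Sets of elements and sets of L-classes correspond through image and preimage under [Lclass];
    equivalence of elements becomes equality of classes. *)
Lemma satisfies_MLP :
  satisfies_ML S <-> forall A : set S, A !=set0 -> exists a, minimalL A a.
Proof.
split=> [ML A [a0 Aa0]|minS C CL [X CX]].
- have [||_ [a Aa <-] amin] := ML (@Lclass S @` A).
  + by move=> _ [a _ <-]; exists a.
  + by exists (Lclass a0), a0.
  exists a; split=> // b Ab ba.
  have Eba : Lclass b = Lclass a.
    apply: amin; first by exists b.
    by exists b, a; split=> //; exact: Lclass_refl.
  by have [] : Lclass a b by rewrite -Eba; exact: Lclass_refl.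
- have [a0 _ Ea0] := CL _ CX.
  have [|a [Ca amin]] := minS [set a | C (Lclass a)].
    by exists a0; rewrite /= Ea0.
  exists (Lclass a) => // Y CY; have [b _ Eb] := CL _ CY.
  rewrite -Eb in CY * => -[y [x [[by_ yb] [ax xa] yx]]].
  (* [leLclass] supplies its own representatives y and x, traded here for b and a. *)
  have ba : leL b a by apply: leL_trans by_ (leL_trans yx xa).
  by apply: eq_Lclass; split=> //; apply: amin.
Qed.

End LPreorder.

Section IdealLPreorder.
Variables (S : semigroupType) (I : ideal S).

Definition to_ideal a (Ia : (I : set S) a) : ideal_semigroup I :=
  exist _ a (mem_set Ia).

Lemma ideal_valP (x : ideal_semigroup I) : (I : set S) (val x).
Proof. exact: set_mem (valP x). Qed.

(** Multipliers must come from I, so this preorder may be strictly finer than the one restricted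
    from S. *)
Lemma ideal_leLP (x y : ideal_semigroup I) :
  leL x y <->
  val x = val y \/ exists2 s, (I : set S) s & val x = s * val y.
Proof.
split=> [/leLP[->|[s ->]]|[/val_inj->|[s Is E]]].
- by left.
- by right; exists (val s) => //; exact: ideal_valP.
- exact: leL_refl.
- by apply/leLP; right; exists (to_ideal Is); apply: val_inj; rewrite E.
Qed.

Lemma ideal_leL (x y : ideal_semigroup I) : leL x y -> leL (val x) (val y).
Proof.
by move=> /ideal_leLP[->|[s _ ->]]; [exact: leL_refl | exact: leL_mull].
Qed.

Definition to_rees a (nIa : (~` I) a) : rees_quotient I :=
  Some (exist _ a (mem_set nIa)).

Lemma rees_mul_SomeP (x y : set_type (~` I)) (z : rees_quotient I) :
  z = (Some x : rees_quotient I) * Some y <->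
  match z with Some c => val c = val x * val y
             | None => (I : set S) (val x * val y) end.
Proof.
rewrite /mul /=; case: insubP => [w _ Ew|nw]; last first.
  split=> [->|]; first by apply: contrapT => /mem_set; exact/negP.
  by case: z => // c Ec; case/negP: nw; rewrite -[X in X \in _]Ec; exact: (valP c).
split=> [->//|]; case: z => [c Ec|Iz].
  by congr Some; apply: val_inj; rewrite Ew.
by have := set_mem (valP w); rewrite Ew.
Qed.

Lemma rees_leL0 (x : rees_quotient I) : leL x None -> x = None.
Proof. by move=> /leLP[//|[[s|] ->]]. Qed.

(** A multiplier s with s * y outside I is itself outside I, since I absorbs products; hence it is
    available in S/I. *)
Lemma rees_leLP (x y : set_type (~` I)) :
  leL (Some x : rees_quotient I) (Some y) <-> leL (val x) (val y).
Proof.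
split=> [/leLP[[->]|[[s|] //]]|/leLP[/val_inj->|[s E]]].
- exact: leL_refl.
- by move=> /rees_mul_SomeP ->; exact: leL_mull.
- exact: leL_refl.
apply/leLP; right.
have nIs : (~` I) s.
  by move=> Is; apply: (set_mem (valP x)); rewrite E; exact: ideal_mulr.
by exists (to_rees nIs); apply/rees_mul_SomeP.
Qed.

Lemma ideal_ML : satisfies_ML S -> satisfies_ML (ideal_semigroup I).
Proof.
move=> /satisfies_MLP minS; apply/satisfies_MLP => A [x0 Ax0].
have [|_ [[x Ax <-] xmin]] := minS (val @` A); first by exists (val x0), x0.
exists x; split=> // y Ay yx.
have [//|[i Ii Ey]] := (ideal_leLP y x).1 yx.
  by move=> /val_inj->; exact: leL_refl.
have /leLP[Ex|[s Ex]] := xmin _ (ex_intro2 _ _ y Ay erefl) (ideal_leL yx).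
  by apply/ideal_leLP; left.
(* x = s y and y = i x give x = (s i s) y, with s i s in I. *)
apply/ideal_leLP; right; exists (s * i * s).
  by apply: ideal_mulr; exact: ideal_mull.
by rewrite -!mulgA -Ex -Ey.
Qed.

(** Outside I the L-preorders of S and S/I agree, so a minimal element found in S/I is minimal in
    S. *)
Lemma minimalL_outside_ideal (A : set S) :
  satisfies_ML (rees_quotient I) -> A !=set0 -> A `<=` ~` I ->
  exists a, minimalL A a.
Proof.
move=> /satisfies_MLP minR [a0 Aa0] AnI.
have [|_ [[x Ax <-] xmin]] :=
    minR ((Some : _ -> rees_quotient I) @` [set x | A (val x)]).
  by exists (to_rees (AnI _ Aa0)), (exist _ a0 (mem_set (AnI _ Aa0))).
exists (val x); split=> // b Ab bx.
pose y : set_type (~` I) := exist _ b (mem_set (AnI _ Ab)).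
apply/(rees_leLP x y)/xmin; first by exists y.
exact/rees_leLP.
Qed.

Lemma rees_ML : satisfies_ML S -> satisfies_ML (rees_quotient I).
Proof.
move=> /satisfies_MLP minS; apply/satisfies_MLP => A [x0 Ax0].
(* Only zero lies below zero, so zero is minimal as soon as it belongs to A; otherwise A lives
   outside I. *)
have [A0|nA0] := pselect (A None).
  by exists None; split=> // b _ /rees_leL0->; exact: leL_refl.
have [|_ [[x Ax <-] xmin]] := minS (val @` [set x | A (Some x)]).
  by case: x0 Ax0 => // x Ax; exists (val x), x.
exists (Some x); split=> // -[y|//] Ay /rees_leLP yx.
by apply/rees_leLP/xmin => //; exists y.
Qed.

Lemma ML_of_ideal_rees :
  satisfies_ML (ideal_semigroup I) -> satisfies_ML (rees_quotient I) ->
  satisfies_ML S.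
Proof.
move=> /satisfies_MLP minI MR; apply/satisfies_MLP => A A0.
have [[a1 [Aa1 Ia1]]|AI0] := pselect (exists a, A a /\ (I : set S) a); last first.
  by apply: minimalL_outside_ideal => // a Aa Ia; apply: AI0; exists a.
have [|x [/= Ax xmin]] := minI [set x | A (val x)].
  by exists (to_ideal Ia1).
set a := val x in Ax; have Ia : (I : set S) a := ideal_valP x.
pose T := [set t | A (t * a)].
have [[t [Tt It]]|TI0] := pselect (exists t, T t /\ (I : set S) t).
  exists a; split=> // b Ab /leLP[->|[s Eb]]; first exact: leL_refl.
  (* As t * a is in A and below a in I, minimality gives a = t * a or a = i * (t * a) with i in I;
     so u is t or i * t. *)
  have [u Iu Ea] : exists2 u, (I : set S) u & a = u * a.
    have Ita : (I : set S) (t * a) by exact: ideal_mull.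
    have : leL x (to_ideal Ita).
      by apply: xmin => //; apply/ideal_leLP; right; exists t.
    move=> /ideal_leLP[/= Ea|[i Ii /= Ea]]; first by exists t.
    by exists (i * t); [exact: ideal_mull | rewrite -mulgA].
  have Ib : (I : set S) b by rewrite Eb; exact: ideal_mull.
  apply: (@ideal_leL x (to_ideal Ib)); apply: xmin => //.
  apply/ideal_leLP; right; exists (s * u); first exact: ideal_mull.
  by rewrite -mulgA -Ea.
have [T0|nT0] := pselect (T !=set0); last first.
  exists a; split=> // b Ab /leLP[->|[s Eb]]; first exact: leL_refl.
  by case: nT0; exists s; rewrite /T /= -Eb.
have [|t [Tt tmin]] := minimalL_outside_ideal MR T0.
  by move=> t Tt It; apply: TI0; exists t.
exists (t * a); split=> // b Ab /leLP[->|[s Eb]]; first exact: leL_refl.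
(* Here s * t is in T and below t, so t is below s * t by minimality; multiplying by a on the right
   preserves this. *)
rewrite Eb mulgA; apply/leL_mulr/tmin; last exact: leL_mull.
by rewrite /T /= -mulgA -Eb.
Qed.

End IdealLPreorder.

Theorem theorem4p16 (S : semigroupType) (I : ideal S) :
  satisfies_ML S <->
  satisfies_ML (ideal_semigroup I) /\ satisfies_ML (rees_quotient I).
Proof.
split=> [MS|[]]; last exact: ML_of_ideal_rees.
by split; [exact: ideal_ML | exact: rees_ML].
Qed.
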